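(* Let $\tau=\{t_k\}_{k=1}^\infty$, $t_k\in[0,1]$, be a nonincreasing weakness sequence. Let $H$ be a real Hilbert space and let $\mathcal{L}$ be a collection of closed subspaces of $H$ with $\bigcap_{L\in\mathcal{L}}L=\{0\}$. Let $m\ge1$ be an integer and let $0\le\alpha\le\frac{t_m}{t_m+2}$. Then for each $f\in H$ and every realization $\{f_n\}_{n\ge0}$, $f_0=f$, of the Weak Remote Projections Algorithm WRPA($\mathcal{L},\tau$) started at $f$, one has $$\|f_m\|\le\left(1+\sum_{k=1}^m t_k^2\right)^{-\alpha/2}\|f\|^{1-\alpha}\,\|f\|_{A_1(\mathcal{D}(\mathcal{L}))}^{\alpha}.$$
   Context: For a closed subspace $L$ of $H$, $\operatorname{Pr}_L$ is the orthogonal projection onto $L$, $L^\perp$ is the orthogonal complement, and $\operatorname{dist}(x,L)=\inf_{y\in L}\|x-y\|$. Weak Remote Projections Algorithm WRPA($\mathcal{L},\tau$): start with $f_0=f\in H$. At the $n$th iteration ($n\ge1$), choose any $L_n\in\mathcal{L}$ satisfying $\operatorname{dist}(f_{n-1},L_n)\ge t_n\sup_{L\in\mathcal{L}}\operatorname{dist}(f_{n-1},L)$ (if $t_n=1$ it is assumed that such a maximizer exists), and set $f_n=\operatorname{Pr}_{L_n}(f_{n-1})$. A realization is any outcome of admissible choices of the $L_n$. Let $S(H)=\{x\in H:\|x\|=1\}$ and $\mathcal{D}(\mathcal{L})=\bigcup_{L\in\mathcal{L}}(L^\perp\cap S(H))$; since $\bigcap_{L\in\mathcal{L}}L=\{0\}$,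 the closed linear span of $\mathcal{D}(\mathcal{L})$ is $H$. $A_1(\mathcal{D}(\mathcal{L}))$ is the closure in $H$ of the convex hull of $\{\pm g: g\in\mathcal{D}(\mathcal{L})\}$, and $\|f\|_{A_1(\mathcal{D}(\mathcal{L}))}=\inf\{M>0: f/M\in A_1(\mathcal{D}(\mathcal{L}))\}$ (with $\inf\emptyset=+\infty$). Conventions: $x^0=1$ for all $x\in[0,+\infty]$, and $(+\infty)^\alpha=+\infty$ for $\alpha>0$. *)

(* Defs.v *)
From HB Require Import structures.
From mathcomp Require Import all_boot all_order all_algebra sesquilinear.
From mathcomp Require Import all_classical all_reals all_analysis.

Set Implicit Arguments.
Unset Strict Implicit.
Unset Printing Implicit Defensive.

Import Order.TTheory GRing.Theory Num.Theory.
Import numFieldNormedType.Exports.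

Local Open Scope classical_set_scope.
Local Open Scope ring_scope.

Section WRPA.
Variables (R : realType) (H : completeNormedModType R).
Variable ip : {dot H for idfun}.

Definition closed_subspace (L : set H) : Prop :=
  closed L /\ submod_closed (mem L : {pred H}).

Definition orthogonal_complement (L : set H) : set H :=
  [set x | forall y, L y -> ip x y = 0].

(* The unique p in L with x - p orthogonal to L; the fallback value 0 is never
   used when L is a closed subspace. *)
Definition orthogonal_projection (L : set H) (x : H) : H :=
  xget 0 [set p | L p /\ orthogonal_complement L (x - p)].

Definition dist (x : H) (L : set H) : R := inf [set `|x - y| | y in L].

Definition dictionary (LL : set (set H)) : set H :=
  \bigcup_(L in LL) (orthogonal_complement L `&` [set x | `|x| = 1]).

Definition convex_hull (A : set H) : set H := smallest (@convex_set R H) A.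

Definition A1 (D : set H) : set H :=
  closure (convex_hull (D `|` [set - g | g in D])).

Definition A1_norm (D : set H) (f : H) : \bar R :=
  ereal_inf [set M%:E | M in [set M : R | 0 < M /\ A1 D (M^-1 *: f)]].

(* Iterations are numbered from 1; [t 0] and [Ls 0] are not used. *)
Definition WRPA_realization (LL : set (set H)) (t : nat -> R)
    (f : H) (fs : nat -> H) : Prop :=
  fs 0%N = f /\
  exists Ls : nat -> set H, forall n, (1 <= n)%N ->
    [/\ LL (Ls n),
        t n * sup [set dist (fs n.-1) L | L in LL] <= dist (fs n.-1) (Ls n) &
        fs n = orthogonal_projection (Ls n) (fs n.-1)].

End WRPA.

(* Main.v *)
(* Projecting onto [L_n] is one step of a weak pure greedy algorithm for the
   dictionary [D]: [f_n] is [f_(n-1)] minus a vector of norm [y_n] orthogonal to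
   [L_n], and [y_n = dist (f_(n-1), L_n)].  If [f] lies in [M A_1], then [f_n]
   lies in [b_n A_1] with [b_n = M + y_1 + ... + y_n], so testing [f_n] against
   itself and using the choice of [L_(n+1)] gives
   [t_(n+1) |f_n|^2 <= b_n y_(n+1)].  With
   [a_n = |f_n|^2 = a_(n-1) - y_n^2] this yields
   [a_m (1 + t_1^2 + ... + t_m^2) <= b_m^2], while [a_n b_n^s] is nonincreasing
   for [s = t_m] since [ln (1 + y_n / b_(n-1)) <= y_n / b_(n-1)] and
   [ln (1 - y_n^2 / a_(n-1)) <= - y_n^2 / a_(n-1)].  Eliminating [b_m] is the
   case [alpha = s / (s + 2)]; smaller [alpha] follow by interpolating with
   [|f_m| <= |f|]. *)

Require Import Defs.
From HB Require Import structures.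
From mathcomp Require Import all_boot all_order all_algebra sesquilinear.
From mathcomp Require Import all_classical all_reals all_analysis.
From mathcomp Require Import ring lra.
Set Implicit Arguments.
Unset Strict Implicit.
Unset Printing Implicit Defensive.
Import Order.TTheory GRing.Theory Num.Theory.
Import numFieldNormedType.Exports.
Local Open Scope classical_set_scope.
Local Open Scope ring_scope.

(** * Real sequences obeying the greedy recursion *)

Section Recursion.
Variables (R : realType) (t a b y : nat -> R) (m : nat).
Hypothesis t_itv : forall n, (n < m)%N -> 0 <= t n.+1 <= 1.
Hypothesis y_ge0 : forall n, (n < m)%N -> 0 <= y n.+1.
Hypothesis a_gt0 : forall n, (n <= m)%N -> 0 < a n.
Hypothesis aS : forall n, (n < m)%N -> a n.+1 = a n - y n.+1 ^+ 2.
Hypothesis bS : forall n, (n < m)%N -> b n.+1 = b n + y n.+1.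
Hypothesis b0_gt0 : 0 < b 0.
Hypothesis ab0 : a 0 <= b 0 ^+ 2.
Hypothesis greedy : forall n, (n < m)%N -> t n.+1 * a n <= b n * y n.+1.

Lemma recursion_b_gt0 n : (n <= m)%N -> 0 < b n.
Proof.
elim: n => [//|n IHn] ltnm.
by rewrite bS // ltr_wpDr ?y_ge0 // IHn // ltnW.
Qed.

(* With [z = a / b^2] the recursion gives [z' <= z (1 - t^2 z)], hence
   [1 / z' >= 1 / z + t^2]. *)
Lemma recursion_ratio n : (n <= m)%N ->
  a n * (1 + \sum_(1 <= k < n.+1) t k ^+ 2) <= b n ^+ 2.
Proof.
elim: n => [|n IHn] ltnm; first by rewrite big_geq // addr0 mulr1.
rewrite big_nat_recr //= addrA; move: (IHn (ltnW ltnm)).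
have: 0 <= \sum_(1 <= k < n.+1) t k ^+ 2.
  by apply: sumr_ge0 => k _; exact: sqr_ge0.
move: (\sum_(1 <= k < n.+1) t k ^+ 2) => S S_ge0 le_aS.
have /andP[t0 t1] := t_itv ltnm.
have a0 := a_gt0 (ltnW ltnm); have b0 := recursion_b_gt0 (ltnW ltnm).
have y0 := y_ge0 ltnm; have a'0 := a_gt0 ltnm; have := greedy ltnm.
move: a'0; rewrite aS // bS //.
move: (a n) (b n) (y n.+1) (t n.+1) a0 b0 y0 t0 t1 le_aS.
move=> A B Y T A0 B0 Y0 T0 T1 le_aS A'0 gr.
have sq_gr : T ^+ 2 * A ^+ 2 <= B ^+ 2 * Y ^+ 2.
  by rewrite -!exprMn ler_sqr ?nnegrE ?mulr_ge0 // ltW.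
have A'le : (A - Y ^+ 2) * B ^+ 2 <= A * (B ^+ 2 - T ^+ 2 * A) by nra.
have T2 : T ^+ 2 <= 1 by rewrite expr_le1.
have AST : A * (1 + S + T ^+ 2) <= B ^+ 2 + T ^+ 2 * A by nra.
have B2 : 0 < B ^+ 2 by rewrite exprn_gt0.
have TA : T ^+ 2 * A <= B ^+ 2 by nra.
have S1 : 0 <= 1 + S + T ^+ 2 by rewrite !addr_ge0 ?sqr_ge0.
(* The growth from [B] to [B + Y] is discarded; after multiplication by [B ^+ 2] the two factors
   combine to [B ^+ 4 - T ^+ 4 * A ^+ 2]. *)
apply: (@le_trans _ _ (B ^+ 2)); last by rewrite ler_sqr ?nnegrE; lra.
rewrite -(ler_pM2r B2) mulrAC.
apply: (le_trans (ler_wpM2r S1 A'le)).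
rewrite mulrAC.
apply: (@le_trans _ _ ((B ^+ 2 + T ^+ 2 * A) * (B ^+ 2 - T ^+ 2 * A))).
  by rewrite ler_wpM2r // subr_ge0.
by rewrite mulrC -subr_sqr -expr2 gerBl sqr_ge0.
Qed.

Lemma recursion_ln (s : R) : 0 < s -> (forall n, (n < m)%N -> s <= t n.+1) ->
  forall n, (n <= m)%N -> ln (a n) + s * ln (b n) <= ln (a 0) + s * ln (b 0).
Proof.
move=> s_gt0 s_le; elim=> [//|n IHn] ltnm; apply: le_trans (IHn (ltnW ltnm)).
case/andP: (t_itv ltnm) => t0 _.
have a0 := a_gt0 (ltnW ltnm); have b0 := recursion_b_gt0 (ltnW ltnm).
have y0 := y_ge0 ltnm; have a'0 := a_gt0 ltnm; have gr := greedy ltnm.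
have st := s_le _ ltnm.
move: a'0; rewrite aS // bS //.
move: (a n) (b n) (y n.+1) (t n.+1) a0 b0 y0 t0 st gr.
move=> A B Y T A0 B0 Y0 T0 sT gr A'0.
have Bv : B + Y = B * (1 + Y / B).
  by rewrite mulrDr mulr1 mulrCA divff ?mulr1 ?gt_eqF.
have Au : A - Y ^+ 2 = A * (1 + - (Y ^+ 2 / A)).
  by rewrite mulrDr mulr1 mulrN mulrCA divff ?mulr1 ?gt_eqF.
have v0 : 0 <= Y / B by rewrite divr_ge0 // ltW.
have u1 : -1 < - (Y ^+ 2 / A) by rewrite ltrN2 ltr_pdivrMr // mul1r -subr_gt0.
have v1 : -1 < Y / B by apply: lt_le_trans v0; rewrite ltrN10.
(* The greedy inequality multiplied by [Y], with [T] lowered to [s]: the gain [s * ln (1 + Y / B)]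
   cannot exceed the loss in [ln A]. *)
have uv : s * (Y / B) <= Y ^+ 2 / A.
  rewrite mulrA ler_pdivrMr // mulrAC ler_pdivlMr //.
  have sA := ler_wpM2r (ltW A0) sT; have := ler_wpM2l Y0 (le_trans sA gr); lra.
have v2 : 0 < 1 + Y / B by rewrite ltr_wpDr.
have u2 : 0 < 1 + - (Y ^+ 2 / A) by rewrite -ltrBlDl sub0r.
rewrite Au Bv !lnM ?posrE //.
have lu := le_ln1Dx u1; have lv := le_ln1Dx v1; nra.
Qed.


(** When [a] is the squared norm, this is twice the logarithm of the desired bound; in logarithms
    the elimination of [b m] is linear. *)
Lemma recursion_bound (s alpha : R) : 0 < s ->
  (forall n, (n < m)%N -> s <= t n.+1) -> 0 <= alpha -> alpha <= s / (s + 2) ->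
  ln (a m) <= - alpha * ln (1 + \sum_(1 <= k < m.+1) t k ^+ 2)
      + (1 - alpha) * ln (a 0) + 2 * alpha * ln (b 0).
Proof.
move=> s_gt0 s_le alpha0 alpha_le.
have sum0 : 0 <= \sum_(1 <= k < m.+1) t k ^+ 2.
  by apply: sumr_ge0 => k _; exact: sqr_ge0.
have am := a_gt0 (leqnn m); have bm := recursion_b_gt0 (leqnn m).
have S1 : 0 < 1 + \sum_(1 <= k < m.+1) t k ^+ 2 by rewrite ltr_pwDl.
have am_le n : (n <= m)%N -> a n <= a 0.
  elim: n => [//|n IHn] ltnm; apply: le_trans (IHn (ltnW ltnm)).
  by rewrite aS // gerBl sqr_ge0.
have := recursion_ratio (leqnn m).
rewrite -ler_ln ?posrE ?mulr_gt0 ?exprn_gt0 // lnM ?posrE // lnXn //.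
have := recursion_ln s_gt0 s_le (leqnn m).
have := am_le _ (leqnn m); rewrite -ler_ln ?posrE ?a_gt0 //.
move: (ln (a m)) (ln (b m)) (ln (a 0)) (ln (b 0)) (ln (1 + _)).
move=> la lb la0 lb0 lS le_a le_ab.
rewrite -[lb *+ 2]mulr_natl => le_ratio.
(* Twice the monotonicity bound plus [s] times the ratio bound: [lb] cancels. *)
have extremal : (s + 2) * la <= 2 * la0 + s * (2 * lb0 - lS).
  have := ler_wpM2l (ltW s_gt0) le_ratio; lra.
(* The weights [alpha / s] and [1 - alpha / s * (s + 2)] give [la] total coefficient 1; the second
   is nonnegative because [alpha <= s / (s + 2)]. *)
have th0 : 0 <= alpha / s by rewrite divr_ge0 // ltW.
have th1 : 0 <= 1 - alpha / s * (s + 2).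
  rewrite subr_ge0 mulrAC ler_pdivrMr // mul1r -ler_pdivlMr //.
  by rewrite addr_gt0.
have ths : alpha / s * s = alpha by rewrite divfK ?gt_eqF.
have := lerD (ler_wpM2l th0 extremal) (ler_wpM2l th1 le_a).
rewrite -[in X in _ -> X]ths; move: (alpha / s) => th; lra.
Qed.

End Recursion.

(** * Inner products, distances and projections *)

Section RealHilbert.
Variables (R : realType) (H : completeNormedModType R).
Variable ip : {dot H for idfun}.
Hypothesis norm_ip : forall x : H, `|x| ^+ 2 = ip x x.

Lemma ip_sym x y : ip x y = ip y x.
Proof. by rewrite hermC /= expr0 mul1r. Qed.

Lemma sqr_normD x y : `|x + y| ^+ 2 = `|x| ^+ 2 + 2 * ip x y + `|y| ^+ 2.
Proof.
rewrite !norm_ip linearDl /= !linearDr /= (ip_sym y x); ring.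
Qed.

(** Cauchy-Schwarz, read off from the squared triangle inequality. *)
Lemma ip_le_norm x y : ip x y <= `|x| * `|y|.
Proof.
have : `|x + y| ^+ 2 <= (`|x| + `|y|) ^+ 2.
  by rewrite ler_sqr ?nnegrE ?addr_ge0 // ler_normD.
by rewrite sqr_normD sqrrD -[_ * _ *+ 2]mulr_natl lerD2r lerD2l ler_pM2l.
Qed.

Lemma abs_ip_le_norm x y : `|ip x y| <= `|x| * `|y|.
Proof.
rewrite ler_norml ip_le_norm andbT lerNl.
by rewrite -linearNr /= -[`|y|]normrN ip_le_norm.
Qed.

(** Shifting [h] by an element of [L] does not change [ip h d]; Cauchy-Schwarz and an infimum over
    the shifts conclude. *)
Lemma orthogonal_ip_le_dist (L : set H) h d : L !=set0 ->
  orthogonal_complement ip L d -> `|ip h d| <= `|d| * dist h L.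
Proof.
move=> [x Lx] Ld; have [->|d0] := eqVneq d 0.
  by rewrite linear0r /= !normr0 mul0r.
rewrite mulrC -ler_pdivrMr ?normr_gt0 //.
apply: lb_le_inf; first by exists `|h - x|, x.
move=> _ [z Lz <-]; rewrite ler_pdivrMr ?normr_gt0 //.
apply: le_trans (abs_ip_le_norm _ _).
by rewrite linearBl /= (ip_sym z) (Ld _ Lz) subr0.
Qed.

Lemma dist_le_norm (L : set H) h x : L x -> dist h L <= `|h - x|.
Proof.
move=> Lx; apply: ge_inf; last by exists x.
by exists 0 => _ [z _ <-].
Qed.

Lemma ip_continuous (h : H) : continuous (ip h).
Proof.
move=> x; apply/cvgrPdist_le => e e0.
have h1 : 0 < `|h| + 1 by rewrite ltr_wpDl.
near=> z; rewrite -linearBr /=; apply: (le_trans (abs_ip_le_norm _ _)).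
apply: (@le_trans _ _ ((`|h| + 1) * `|x - z|)).
  by rewrite ler_wpM2r // lerDl.
rewrite mulrC -ler_pdivlMr //; near: z.
by apply: cvgr_dist_le; [exact: cvg_id|rewrite divr_gt0].
Unshelve. all: by end_near. Qed.

(** A sublevel set of a continuous sublinear [p] is closed and convex, so it contains [A1 D] once it
    contains every [g] and [- g]. It serves for [ip h] and for the norm. *)
Lemma A1_sublinear_le (D : set H) (p : H -> R) (s : R) :
  continuous p -> (forall x y, p (x + y) <= p x + p y) ->
  (forall c x, 0 <= c -> p (c *: x) = c * p x) ->
  (forall g, D g -> p g <= s /\ p (- g) <= s) ->
  forall x, A1 D x -> p x <= s.
Proof.
move=> p_cont pD pZ pDs.
have sub_hull : convex_hull (D `|` [set - g | g in D]) `<=` [set x | p x <= s].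
  apply: smallest_sub => [x y l|x [/pDs[]//|[g /pDs[_ ?] <-//]]].
  rewrite !inE /= => px py.
  have l0 : 0 <= l%:num by [].
  have l1 : 0 <= 1 - l%:num by rewrite subr_ge0.
  apply: (le_trans (pD _ _)); rewrite !pZ //.
  move: (l%:num) l0 l1 => c c0 c1; rewrite /unstable.onem; nra.
move=> x /(closure_subset sub_hull).
have cl : closed [set x | p x <= s].
  apply: (@closed_comp _ _ p [set r | r <= s]) => [? _|]; first exact: p_cont.
  exact: closed_le.
by move/closure_id: cl => <-.
Qed.

(** A nonzero value cannot be the fallback of [xget]. *)
Lemma orthogonal_projectionP (L : set H) (x : H) :
  orthogonal_projection ip L x != 0 ->
  L (orthogonal_projection ip L x) /\
  orthogonal_complement ip L (x - orthogonal_projection ip L x).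
Proof.
rewrite /orthogonal_projection; case: xgetP => [p _ //|_].
by rewrite eqxx.
Qed.

Lemma sqr_norm_projection (L : set H) (x p : H) :
  L p -> orthogonal_complement ip L (x - p) ->
  `|p| ^+ 2 = `|x| ^+ 2 - `|x - p| ^+ 2.
Proof.
move=> Lp orth; have := sqr_normD (x - p) p.
by rewrite subrK orth // mulr0 addr0 => ->; rewrite addrC addKr.
Qed.

(* If no projection existed, its fallback value 0 would satisfy this as well, so
   the Hilbert projection theorem is not needed. *)
Lemma norm_orthogonal_projection (L : set H) (x : H) :
  `|orthogonal_projection ip L x| <= `|x|.
Proof.
have [->|p0] := eqVneq (orthogonal_projection ip L x) 0.
  by rewrite normr0.
have [Lp orth] := orthogonal_projectionP p0.
by rewrite -ler_sqr ?nnegrE // (sqr_norm_projection Lp orth) gerBl sqr_ge0.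
Qed.

Lemma sup_dist_ge (LL : set (set H)) (h : H) (L : set H) :
  (forall L, LL L -> L 0) -> LL L ->
  dist h L <= sup [set dist h L | L in LL].
Proof.
move=> LL0 LLL; apply: ub_le_sup; last by exists L.
(* As 0 lies in every subspace, the norm of [h] bounds all distances, so [sup] is a genuine
   supremum. *)
by exists `|h| => _ [K /LL0 K0 <-]; rewrite -[h in leRHS]subr0 dist_le_norm.
Qed.

(** * Reduction of a realization to the recursion *)

Section Realization.
Variables (t : nat -> R) (LL : set (set H)) (fs : nat -> H) (Ls : nat -> set H).
Variable (m : nat).
Hypothesis t_itv : forall k, (1 <= k)%N -> 0 <= t k <= 1.
Hypothesis LL0 : forall L, LL L -> L 0.
Hypothesis fs_step : forall n, [/\ LL (Ls n.+1),
  t n.+1 * sup [set dist (fs n) L | L in LL] <= dist (fs n) (Ls n.+1) &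
  fs n.+1 = orthogonal_projection ip (Ls n.+1) (fs n)].

Lemma realization_norm_noninc n k : (n <= k)%N -> `|fs k| <= `|fs n|.
Proof.
elim: k => [|k IHk]; first by rewrite leqn0 => /eqP ->.
rewrite leq_eqVlt => /predU1P[->//|/IHk]; apply: le_trans.
by have [_ _ ->] := fs_step k; exact: norm_orthogonal_projection.
Qed.

Hypothesis fsm_neq0 : fs m != 0.

(** Norms never increase, so no iterate up to [m] vanishes; hence these projections are genuine and
    the logarithms of the norms make sense. *)
Lemma realization_neq0 n : (n <= m)%N -> fs n != 0.
Proof.
move/realization_norm_noninc; rewrite -normr_gt0; apply: lt_le_trans.
by rewrite normr_gt0.
Qed.

Lemma realization_proj n : (n < m)%N -> Ls n.+1 (fs n.+1) /\
  orthogonal_complement ip (Ls n.+1) (fs n - fs n.+1).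
Proof.
move=> /realization_neq0; have [_ _ ->] := fs_step n.
exact: orthogonal_projectionP.
Qed.

Variable M : R.
Hypothesis M_gt0 : 0 < M.
Hypothesis A1_f : A1 (dictionary ip LL) (M^-1 *: fs 0%N).

Let y n := `|fs n.-1 - fs n|.
Let b n := M + \sum_(1 <= k < n.+1) y k.
Let s h := sup [set dist h L | L in LL].

(** A dual form of [fs n] lying in [b n] times [A1]: [s h] bounds [ip h] on the dictionary, and step
    [n.+1] subtracts a vector of norm [y n.+1] orthogonal to [Ls n.+1]. *)
Lemma realization_ip_le n h : (n <= m)%N -> ip h (fs n) <= b n * s h.
Proof.
elim: n => [_|n IHn ltnm].
  rewrite /b big_geq // addr0 mulrC -ler_pdivrMr // mulrC -linearZr_LR /=.
  apply: (A1_sublinear_le (@ip_continuous h)) A1_f.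
  - by move=> x z; rewrite linearDr.
  - by move=> c x _; rewrite linearZr_LR.
  - move=> g [L LLL [Lg /= g1]].
    have : `|ip h g| <= s h.
      apply: le_trans (sup_dist_ge _ LL0 LLL); rewrite -[leRHS]mul1r -g1.
      by apply: orthogonal_ip_le_dist => //; exists 0; exact: LL0.
    by rewrite ler_norml linearNr lerNl => /andP[].
have [_ orth] := realization_proj ltnm; have [LLn _ _] := fs_step n.
rewrite -[fs n.+1](subKr (fs n)) linearBr /=.
rewrite /b big_nat_recr //= addrA mulrDl lerD ?IHn 1?ltnW //.
rewrite -linearNr /= -[y _]normrN; apply: (le_trans (ler_norm _)).
rewrite linearNr normrN normrN.
apply: (@le_trans _ _ (y n.+1 * dist h (Ls n.+1))).
  by apply: orthogonal_ip_le_dist => //; exists 0; exact: LL0.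
by apply: ler_wpM2l; [exact: normr_ge0|exact: sup_dist_ge].
Qed.

Lemma realization_bound (w alpha : R) : 0 < w ->
  (forall n, (n < m)%N -> w <= t n.+1) -> 0 <= alpha -> alpha <= w / (w + 2) ->
  `|fs m| <= (1 + \sum_(1 <= k < m.+1) t k ^+ 2) `^ (- (alpha / 2))
             * `|fs 0%N| `^ (1 - alpha) * M `^ alpha.
Proof.
move=> w0 w_le alpha0 alpha_le.
have b_gt0 n : 0 < b n.
  by rewrite ltr_pwDl //; apply: sumr_ge0 => k _; exact: normr_ge0.
have b0E : b 0%N = M by rewrite /b big_geq // addr0.
have f_gt0 n : (n <= m)%N -> 0 < `|fs n|.
  by rewrite normr_gt0; exact: realization_neq0.
(* Dictionary elements are unit vectors, so [A1] lies in the unit ball. *)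
have ab0 : `|fs 0%N| ^+ 2 <= b 0%N ^+ 2.
  rewrite b0E ler_sqr ?nnegrE ?(ltW M_gt0) //.
  rewrite -[leRHS]mul1r -ler_pdivrMr // mulrC.
  have Mi : 0 <= M^-1 by rewrite invr_ge0 ltW.
  rewrite -[X in X * _](ger0_norm Mi) -normrZ.
  apply: (A1_sublinear_le (@norm_continuous _ _)) A1_f.
  - exact: ler_normD.
  - by move=> c x c0; rewrite normrZ ger0_norm.
  - by move=> g [L _ [_ /= g1]]; rewrite normrN g1.
have t_itv' n : (n < m)%N -> 0 <= t n.+1 <= 1 by move=> _; exact: t_itv.
have y0 n : (n < m)%N -> 0 <= y n.+1 by move=> _; exact: normr_ge0.
have a_gt0 n : (n <= m)%N -> 0 < `|fs n| ^+ 2.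
  by move=> nm; rewrite exprn_gt0 ?f_gt0.
have aS n : (n < m)%N -> `|fs n.+1| ^+ 2 = `|fs n| ^+ 2 - y n.+1 ^+ 2.
  by move=> /realization_proj[Lp orth]; exact: sqr_norm_projection Lp orth.
have bS n : (n < m)%N -> b n.+1 = b n + y n.+1.
  by move=> _; rewrite /b big_nat_recr //= addrA.
(* The previous lemma with [h = fs n]; moreover [dist (fs n) (Ls n.+1) <= y n.+1] because [fs n.+1]
   lies in [Ls n.+1]. *)
have greedy n : (n < m)%N -> t n.+1 * `|fs n| ^+ 2 <= b n * y n.+1.
  move=> nm; have /andP[t0 _] := t_itv' _ nm; have [_ gr _] := fs_step n.
  have [Lp _] := realization_proj nm.
  rewrite norm_ip.
  apply: (le_trans (ler_wpM2l t0 (realization_ip_le _ (ltnW nm)))).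
  rewrite mulrCA; apply: (ler_wpM2l (ltW (b_gt0 n))); apply: (le_trans gr).
  exact: dist_le_norm.
have bound := recursion_bound t_itv' y0 a_gt0 aS bS (b_gt0 0%N) ab0
  greedy w0 w_le alpha0 alpha_le.
have fm := f_gt0 _ (leqnn m); have f0 := f_gt0 _ (leq0n m).
have sum0 : 0 <= \sum_(1 <= k < m.+1) t k ^+ 2.
  by apply: sumr_ge0 => k _; exact: sqr_ge0.
have S1 : 0 < 1 + \sum_(1 <= k < m.+1) t k ^+ 2 by rewrite ltr_pwDl.
rewrite b0E !lnXn // in bound.
rewrite -ler_ln ?posrE ?mulr_gt0 ?powR_gt0 //.
rewrite !lnM ?posrE ?mulr_gt0 ?powR_gt0 //.
rewrite !ln_powR; move: bound.
set lf := ln `|fs m|; set lf0 := ln `|fs 0%N|; lra.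
Qed.

End Realization.

End RealHilbert.

(** * Degenerate cases and passage to the infimum over [M] *)

Theorem theorem5p8 (R : realType) (H : completeNormedModType R)
    (ip : {dot H for idfun}) (norm_ip : forall x : H, `|x| ^+ 2 = ip x x)
    (t : nat -> R)
    (t_itv : forall k, (1 <= k)%N -> 0 <= t k <= 1)
    (t_noninc : forall j k, (1 <= j)%N -> (j <= k)%N -> t k <= t j)
    (LL : set (set H))
    (LL_closed : forall L, LL L -> closed_subspace L)
    (LL_cap : \bigcap_(L in LL) L = [set 0])
    (m : nat) (m_ge1 : (1 <= m)%N)
    (alpha : R) (alpha_ge0 : 0 <= alpha) (alpha_le : alpha <= t m / (t m + 2))
    (f : H) (fs : nat -> H) (fs_wrpa : WRPA_realization ip LL t f fs) :
  (`|fs m|%:E <=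
     ((1 + \sum_(1 <= k < m.+1) t k ^+ 2) `^ (- (alpha / 2)))%:E
     * (`|f| `^ (1 - alpha))%:E
     * A1_norm (dictionary ip LL) f `^ alpha)%E.
Proof.
have [<- [Ls step]] := fs_wrpa.
have {}step n := step n.+1 isT.
have LL0 L : LL L -> L 0.
  by move=> /LL_closed[_ [L0 _]]; move: L0; rewrite unfold_in /= => /set_mem.
have [fm0|fm0] := eqVneq (fs m) 0.
  by rewrite fm0 normr0 !mule_ge0 ?poweR_ge0 // lee_fin powR_ge0.
(* Treated apart because [alpha^-1] occurs below; a zeroth power is 1 even when [A1_norm] is
   infinite. *)
have [alpha0|alpha_neq0] := eqVneq alpha 0.
  rewrite alpha0 mul0r oppr0 powRr0 addr0 poweRe0 mul1e mule1 powRr1 // lee_fin.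
  exact: (realization_norm_noninc norm_ip step).
have alpha_gt0 : 0 < alpha by rewrite lt_def alpha_neq0.
have /andP[tm0 _] := t_itv m m_ge1.
have tm_gt0 : 0 < t m.
  rewrite lt_def tm0 andbT; apply: contraTN alpha_gt0 => /eqP tm_eq0.
  by rewrite -leNgt (le_trans alpha_le) // tm_eq0 mul0r.
have tm_le n : (n < m)%N -> t m <= t n.+1 by exact: t_noninc.
have f_gt0 : 0 < `|fs 0%N|.
  by rewrite normr_gt0; exact: (realization_neq0 norm_ip step fm0).
set S := 1 + _; set N := A1_norm _ _.
have S_gt0 : 0 < S.
  by rewrite ltr_pwDl // sumr_ge0 // => k _; exact: sqr_ge0.
rewrite -EFinM; set c := S `^ _ * `|fs 0%N| `^ _.
have c_gt0 : 0 < c by rewrite mulr_gt0 // powR_gt0.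
have q0 : 0 <= `|fs m| / c by rewrite divr_ge0 // ltW.
(* Solving the bound, [c] times the power [alpha] of [M], for [M] gives one lower bound for all
   admissible [M], hence for [N], be it finite or not. *)
have le_N : (((`|fs m| / c) `^ alpha^-1)%:E <= N)%E.
  apply/ereal_infP => _ [M [M_gt0 A1M] <-]; rewrite lee_fin.
  have MM : M = (M `^ alpha) `^ alpha^-1.
    by rewrite -powRrM divff // powRr1 // ltW.
  rewrite MM ge0_ler_powR ?nnegrE ?powR_ge0 ?invr_ge0 //.
  rewrite ler_pdivrMr // mulrC.
  exact: (realization_bound norm_ip t_itv LL0 step fm0 M_gt0 A1M tm_gt0).
have N0 : (0 <= N)%E by apply: le_trans le_N; rewrite lee_fin powR_ge0.
have : (((`|fs m| / c) `^ alpha^-1)%:E `^ alpha <= N `^ alpha)%E.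
  apply: gt0_ler_poweR => //; rewrite in_itv /= leey andbT //.
  by rewrite lee_fin powR_ge0.
rewrite poweR_EFin -powRrM mulVf // powRr1 //.
have c0 : (0 <= c%:E)%E by rewrite lee_fin ltW.
by move=> /(lee_wpmul2l c0); rewrite -EFinM mulrCA divff ?mulr1 ?gt_eqF //.
Qed.
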